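(* Let $d\ge 1$, $n\ge 2$, $N=\binom n2$ and $D=\binom{d+2}{2}$. Let ${\bf E}$ be a $D\times N$ complex matrix of rank $r$. If the image ${\bf E}(L_{d,n})$ (a constructible set) does not have dimension $r$, then $r=D$ and ${\bf E}$ has $K_{d+2}$ support, i.e., there is a set $U$ of $d+2$ vertices such that every column of ${\bf E}$ indexed by an edge not contained in $U$ is zero.
   Context: Index coordinates of $\mathbb C^N$ (and columns of ${\bf E}$) by the edges $\{i,j\}$ of $K_n$. For a complex configuration ${\bf p}=({\bf p}_1,\dots,{\bf p}_n)$ in $\mathbb C^d$, $m({\bf p})\in\mathbb C^N$ has coordinates $m_{ij}({\bf p})=\sum_{k=1}^d({\bf p}_i^k-{\bf p}_j^k)^2$ (no conjugation); $M_{d,n}$ is the image of $m$ over all complex configurations. With $s$ the coordinatewise squaring map on $\mathbb C^N$, $L_{d,n}=s^{-1}(M_{d,n})$. *)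

(* Defs.v *)
From HB Require Import structures.
From mathcomp Require Import all_boot all_algebra.
From mathcomp Require Import reals.
From mathcomp Require Import complex.
From mathcomp Require Import mpoly.

Set Implicit Arguments.
Unset Strict Implicit.
Unset Printing Implicit Defensive.

Import GRing.Theory.
Local Open Scope ring_scope.

Definition edge (n : nat) := {p : 'I_n * 'I_n | (p.1 < p.2)%N}.
Definition edge_src n (e : edge n) : 'I_n := (val e).1.
Definition edge_tgt n (e : edge n) : 'I_n := (val e).2.

Section Defs.
Variable R : realType.
Local Notation C := R[i].

Definition mmap d n (p : 'I_n -> 'I_d -> C) : edge n -> C :=
  fun e => \sum_(k < d) (p (edge_src e) k - p (edge_tgt e) k) ^+ 2.

Definition Mset d n : (edge n -> C) -> Prop :=
  fun v => exists p : 'I_n -> 'I_d -> C, v = mmap p.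

Definition Lset d n : (edge n -> C) -> Prop :=
  fun l => Mset d (fun e => l e ^+ 2).

Definition mx_apply D n (E : 'M[C]_(D, #|{: edge n}|)) (l : edge n -> C) : 'I_D -> C :=
  fun i => \sum_(j < #|{: edge n}|) E i j * l (enum_val j).

Definition mx_image D n (E : 'M[C]_(D, #|{: edge n}|)) (S : (edge n -> C) -> Prop)
  : ('I_D -> C) -> Prop :=
  fun w => exists l, S l /\ w = mx_apply E l.

Definition coords_indep_on D k (S : ('I_D -> C) -> Prop) (f : 'I_k -> 'I_D) : Prop :=
  forall q : {mpoly C[k]}, (forall x, S x -> q.@[fun j => x (f j)] = 0) -> q = 0.

(* Dimension of S (that of its Zariski closure): the maximal number of coordinate
   functions that are algebraically independent on S. *)
Definition zdim_eq D (S : ('I_D -> C) -> Prop) (r : nat) : Prop :=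
  (exists f : 'I_r -> 'I_D, injective f /\ coords_indep_on S f) /\
  (forall k (f : 'I_k -> 'I_D), injective f -> coords_indep_on S f -> (k <= r)%N).

End Defs.

Definition has_K_support (R : realType) D n (E : 'M[R[i]]_(D, #|{: edge n}|)) (m : nat) : Prop :=
  exists U : {set 'I_n}, #|U| = m /\
    forall e : edge n, ~~ ((edge_src e \in U) && (edge_tgt e \in U)) ->
      forall i : 'I_D, E i (enum_rank e) = 0.

(* Main.v *)
(* E(L) has dimension r as soon as some r linearly independent columns of E are
   indexed by an edge set B that is independent in the generic rigidity matroid.
   Indeed L is stable under sign flips of coordinates, which act on the tangent
   spaces; the r x r determinant expressing that E maps a tangent space onto the
   r-dimensional column space is affine in each sign, and setting the signs
   outside B to 0 leaves a nonzero product of a minor of E by a minor of the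
   rigidity matrix, so some choice of signs makes it nonzero.  A polynomial
   vanishing on E(L) is then killed by its expansion along curves on L.

   At points of the moment curve, which are in general position, a stress has
   degree at least d + 1 at every vertex that it meets, so a dependent set of at
   most D edges is the edge set of a K_{d+2}.  If every column basis of E is of
   this kind then, by the exchange property, there is only one, and the other
   columns of E vanish. *)

Require Import Defs.
From HB Require Import structures.
From mathcomp Require Import all_boot all_order all_algebra.
From mathcomp Require Import boolp reals.
From mathcomp Require Import complex.
From mathcomp Require Import mpoly.
From mathcomp Require Import ring zify.

Set Implicit Arguments.
Unset Strict Implicit.
Unset Printing Implicit Defensive.

Import Order.TTheory GRing.Theory Num.Theory.
Local Open Scope ring_scope.

(** * Polynomials vanishing along curves *)

(** The lowest digit is the remainder modulo [b] and the others form the quotient. This lets the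
    Kronecker substitution below separate monomials. *)
Lemma digits_inj (b r : nat) (m1 m2 : 'I_r -> nat) :
    (forall i, m1 i < b)%N -> (forall i, m2 i < b)%N ->
    (\sum_(i < r) m1 i * b ^ i = \sum_(i < r) m2 i * b ^ i)%N ->
  m1 =1 m2.
Proof.
elim: r m1 m2 => [|r IHr] m1 m2 m1b m2b; first by move=> _ [].
have split_digits (m : 'I_r.+1 -> nat) : (\sum_(i < r.+1) m i * b ^ i
    = (\sum_(i < r) m (lift ord0 i) * b ^ i) * b + m ord0)%N.
  rewrite big_ord_recl expn0 muln1 addnC big_distrl /=; congr addn.
  by apply: eq_bigr => i _; rewrite /bump /= add1n expnSr mulnA.
rewrite !split_digits => eq12.
have b_gt0 : (0 < b)%N by apply: leq_ltn_trans (m1b ord0).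
have eq0 : m1 ord0 = m2 ord0.
  by have := congr1 (modn^~ b) eq12; rewrite /= !modnMDl !modn_small.
have eqS := congr1 (divn^~ b) eq12.
rewrite /= !divnMDl // !divn_small // !addn0 in eqS.
move=> i; case: (unliftP ord0 i) => [j ->|-> //].
by apply: (IHr (m1 \o lift ord0) (m2 \o lift ord0)) => // k /=.
Qed.

Lemma poly_eq0_vanish (F : numDomainType) (p : {poly F}) :
  (forall x, p.[x] = 0) -> p = 0.
Proof.
(* In characteristic 0 the integers below [size p] are distinct roots, one more than the degree
   allows. *)
move=> p0; apply: (@roots_geq_poly_eq0 _ _ [seq i%:R | i <- iota 0 (size p)]).
- by apply/allP => x _; apply/rootP.
- by rewrite map_inj_uniq ?iota_uniq //; apply: mulrIn; rewrite oner_eq0.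
- by rewrite size_map size_iota.
Qed.

(* Kronecker substitution [x_i := y ^ (b ^ i)] with [b] exceeding all exponents. *)
Lemma mpoly_eq0_vanish (F : numDomainType) (r : nat) (p : {mpoly F[r]}) :
  (forall x, p.@[x] = 0) -> p = 0.
Proof.
move=> p0; pose b := msize p; pose wt (m : 'X_{1..r}) := (\sum_(i < r) m i * b ^ i)%N.
have m_lt m i : m \in msupp p -> (m i < b)%N.
  move=> m_p; apply: leq_ltn_trans (msize_mdeg_lt m_p).
  by rewrite mdegE (bigD1 i) //= leq_addr.
pose u : {poly F} := \sum_(m <- msupp p) p@_m *: 'X^(wt m).
have u0 : u = 0.
  apply: poly_eq0_vanish => y; rewrite -(p0 (fun i => y ^+ (b ^ i))) mevalE.
  rewrite horner_sum; apply: eq_bigr => m _; rewrite hornerZ hornerXn; congr (_ * _).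
  by rewrite /wt expr_sum; apply: eq_bigr => i _; rewrite -exprM mulnC.
apply/mpolyP => m; rewrite mcoeff0; case: (boolP (m \in msupp p)) => [m_p|/memN_msupp_eq0 //].
have := congr1 (fun v : {poly F} => v`_(wt m)) u0.
rewrite /= coef0 coef_sum (bigD1_seq m) //= coefZ coefXn eqxx mulr1.
rewrite big_seq_cond big1 ?addr0 // => m' /andP[m'_p neq].
rewrite coefZ coefXn; case: eqP => [eqw|_]; last by rewrite mulr0.
case/eqP: neq; apply/mnmP => i; apply: esym.
by apply: (@digits_inj b r m m') => // j; apply: m_lt.
Qed.

(** * First-order approximation as a real parameter tends to 0 *)

Section LinearApproximation.
Variable C : numClosedFieldType.
Implicit Types (f g : C -> C).

(** This says f(t) = c + O(t) on the real interval (0, 1], as [0 < t] forces [t] to be real. The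
    explicit bound stands for a limit, and leaving out [t = 0] admits difference quotients. *)
Definition approx0 f (c : C) :=
  exists2 M, 0 <= M & forall t, 0 < t <= 1 -> `|f t - c| <= M * t.

Lemma approx0_ext f g c :
  (forall t, 0 < t <= 1 -> f t = g t) -> approx0 f c -> approx0 g c.
Proof. by move=> fg [M M0 fM]; exists M => // t t01; rewrite -fg // fM. Qed.

Lemma approx0_cst c : approx0 (fun=> c) c.
Proof. by exists 0 => // t _; rewrite subrr normr0 mul0r. Qed.

Lemma approx0_id : approx0 id 0.
Proof. by exists 1 => // t /andP[t0 _]; rewrite subr0 mul1r gtr0_norm. Qed.

Lemma approx0D f g c c' :
  approx0 f c -> approx0 g c' -> approx0 (fun t => f t + g t) (c + c').
Proof.
move=> [M M0 fM] [N N0 gN]; exists (M + N) => [|t t01]; first exact: addr_ge0.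
rewrite mulrDl opprD addrACA; apply: le_trans (ler_normD _ _) _.
by rewrite lerD ?fM ?gN.
Qed.

Lemma approx0M f g c c' :
  approx0 f c -> approx0 g c' -> approx0 (fun t => f t * g t) (c * c').
Proof.
move=> [M M0 fM] [N N0 gN]; exists (M * (N + `|c'|) + `|c| * N) => [|t t01].
  by rewrite addr_ge0 ?mulr_ge0 ?addr_ge0.
have -> : f t * g t - c * c' = (f t - c) * g t + c * (g t - c') by ring.
apply: le_trans (ler_normD _ _) _; rewrite !normrM mulrDl lerD //.
  rewrite mulrAC ler_pM ?fM // -(subrK c' (g t)).
  apply: le_trans (ler_normD _ _) _; rewrite lerD2r.
  case/andP: (t01) => t0 t1; apply: le_trans (gN _ t01) _.
  by rewrite -[leRHS]mulr1 ler_wpM2l.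
by rewrite -mulrA ler_wpM2l ?gN.
Qed.

Lemma approx0X f c k : approx0 f c -> approx0 (fun t => f t ^+ k) (c ^+ k).
Proof.
move=> fc; elim: k => [|k IHk]; first by rewrite expr0; apply: approx0_cst.
case: (approx0M fc IHk) => M M0 le; exists M => // t t01; rewrite !exprS; exact: le.
Qed.

Lemma approx0_sum (I : Type) (s : seq I) (P : pred I) (f : I -> C -> C) c :
    (forall i, P i -> approx0 (f i) (c i)) ->
  approx0 (fun t => \sum_(i <- s | P i) f i t) (\sum_(i <- s | P i) c i).
Proof.
move=> fc; elim: s => [|i s IHs].
  by exists 0 => // t _; rewrite !big_nil subrr normr0 mul0r.
case: (boolP (P i)) => Pi; last first.
  by case: IHs => M M0 le; exists M => // t t01; rewrite !big_cons (negPf Pi) le.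
case: (approx0D (fc i Pi) IHs) => N N0 le.
by exists N => // t t01; rewrite !big_cons Pi; apply: le.
Qed.

Lemma approx0_prod (I : Type) (s : seq I) (P : pred I) (f : I -> C -> C) c :
    (forall i, P i -> approx0 (f i) (c i)) ->
  approx0 (fun t => \prod_(i <- s | P i) f i t) (\prod_(i <- s | P i) c i).
Proof.
move=> fc; elim: s => [|i s IHs].
  by exists 0 => // t _; rewrite !big_nil subrr normr0 mul0r.
case: (boolP (P i)) => Pi; last first.
  by case: IHs => M M0 le; exists M => // t t01; rewrite !big_cons (negPf Pi) le.
case: (approx0M (fc i Pi) IHs) => N N0 le.
by exists N => // t t01; rewrite !big_cons Pi; apply: le.
Qed.

Lemma approx0_eq0 f c : (forall t, 0 < t <= 1 -> f t = 0) -> approx0 f c -> c = 0.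
Proof.
move=> f0 [M M0 fM]; apply/eqP; case: (boolP (c == 0)) => // c_neq0.
have c_gt0 : 0 < `|c| by rewrite normr_gt0.
(* At [t = |c| / b] the bound gives [b <= M], although [b] exceeds [M]; also [b >= |c|] keeps [t] at
   most 1. *)
pose b := `|c| + (M + `|c|); have b_gt0 : 0 < b by rewrite ltr_pwDl ?addr_ge0.
have t01 : 0 < `|c| / b <= 1.
  by rewrite divr_gt0 //= ler_pdivrMr // mul1r lerDl addr_ge0.
have := fM _ t01; rewrite f0 // sub0r normrN mulrCA -[leLHS]mulr1 ler_pM2l //.
rewrite ler_pdivlMr // mul1r => leM.
have ltM : M < b by rewrite /b addrCA ltrDl addr_gt0.
by have := lt_le_trans ltM leM; rewrite ltxx.
Qed.

(** Implicit differentiation of y^2 = m. No continuous branch is built: each [t] gets a root with |y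
    + l| >= |l|, so that y - l = (m - l^2) / (y + l) is O(t). *)
Lemma sqrt_approx (m : C -> C) (l v : C) :
    l != 0 -> approx0 (fun t => (m t - l ^+ 2) / t) (2 * l * v) ->
  exists2 y : C -> C, forall t, y t ^+ 2 = m t & approx0 (fun t => (y t - l) / t) v.
Proof.
move=> l0 [M M0 mM].
pose y t := if `|l| <= `|sqrtC (m t) + l| then sqrtC (m t) else - sqrtC (m t).
have y2 t : y t ^+ 2 = m t by rewrite /y; case: ifP => _; rewrite ?sqrrN sqrtCK.
(* For the two roots, the values of y + l add up to 2l, so they cannot both be shorter than [l]. *)
have yl t : `|l| <= `|y t + l|.
  rewrite /y; case: ifP => // /negbT.
  rewrite -real_ltNge ?normr_real // => lt1.
  rewrite real_leNgt ?normr_real //; apply/negP => lt2.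
  have := le_lt_trans (ler_normD _ _) (ltrD lt1 lt2).
  have -> : sqrtC (m t) + l + (- sqrtC (m t) + l) = l *+ 2 by ring.
  by rewrite normrMn mulr2n ltxx.
exists y => //; pose K := `|2 * l * v| + M.
have K0 : 0 <= K by rewrite addr_ge0.
have l_gt0 : 0 < `|l| by rewrite normr_gt0.
have ymK t : 0 < t <= 1 -> `|y t - l| <= K / `|l| * t.
  move=> t01; have /andP[t0 t1] := t01.
  rewrite mulrAC ler_pdivlMr //; apply: le_trans (_ : `|y t ^+ 2 - l ^+ 2| <= _).
    by rewrite subr_sqr normrM ler_wpM2l.
  have -> : y t ^+ 2 - l ^+ 2 = ((m t - l ^+ 2) / t) * t by rewrite y2 divfK ?gt_eqF.
  rewrite normrM (gtr0_norm t0) ler_wpM2r ?(ltW t0) //.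
  rewrite -(subrK (2 * l * v) (_ / t)); apply: le_trans (ler_normD _ _) _.
  rewrite addrC lerD2l; apply: le_trans (mM _ t01) _.
  by rewrite -[leRHS]mulr1 ler_wpM2l.
exists ((M + (K / `|l|) ^+ 2) / `|2 * l|) => [|t t01].
  by rewrite divr_ge0 // addr_ge0 // exprn_ge0 // divr_ge0.
have /andP[t0 t1] := t01.
have t_neq0 : t != 0 by rewrite gt_eqF.
(* Solves m - l^2 = 2l(y - l) + (y - l)^2 for the linear term; the square is O(t^2), hence O(t)
   after division by [t]. *)
have -> : (y t - l) / t - v
    = ((m t - l ^+ 2) / t - 2 * l * v - (y t - l) ^+ 2 / t) / (2 * l).
  by rewrite -y2; field; rewrite ?t_neq0 ?l0.
rewrite normrM normfV [leRHS]mulrAC ler_wpM2r ?invr_ge0 // [leRHS]mulrDl.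
apply: le_trans (ler_normB _ _) _; rewrite lerD ?mM //.
rewrite normrM normfV (gtr0_norm t0) normrX ler_pdivrMr // -mulrA -expr2 -exprMn.
by rewrite lerXn2r ?nnegrE ?ymK // mulr_ge0 ?divr_ge0 // ltW.
Qed.

(* Expanding [q] at [z] and letting [t] tend to 0 kills its lowest homogeneous part. *)
Lemma mpoly_eq0_curves (r : nat) (q : {mpoly C[r]}) (z : 'I_r -> C) :
    (forall u : 'I_r -> C, exists2 w : 'I_r -> C -> C,
       forall i, approx0 (w i) (u i) &
       forall t, 0 < t <= 1 -> q.@[fun i => z i + t * w i t] = 0) ->
  q = 0.
Proof.
move=> curves; pose q' := q \mPo [tuple (z i)%:MP + 'X_i | i < r].
have q'E x : q'.@[x] = q.@[fun i => z i + x i].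
  rewrite comp_mpoly_meval; apply: meval_eq => i.
  by rewrite tnth_mktuple mevalD mevalC mevalXU.
suff q'0 : q' = 0.
  apply: mpoly_eq0_vanish => x.
  have := q'E (fun i => x i - z i); rewrite q'0 meval0 => ->.
  by apply: meval_eq => i; rewrite addrC subrK.
apply/eqP/negPn/negP => q'_neq0.
have mlead_supp : mlead q' \in msupp q' by apply: mlead_supp.
have ex_deg : exists k, has (fun m => mdeg m == k) (msupp q').
  by exists (mdeg (mlead q')); apply/hasP; exists (mlead q').
pose k := ex_minn ex_deg.
have [m0 m0_q' m0k] : exists2 m0, m0 \in msupp q' & mdeg m0 = k.
  by rewrite /k; case: ex_minnP => j /hasP[m mq /eqP<-] _; exists m.
have k_min m : m \in msupp q' -> (k <= mdeg m)%N.
  move=> mq; rewrite /k; case: ex_minnP => j _; apply; apply/hasP.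
  by exists m => //=.
have low0 : pihomog mdeg k q' = 0.
  apply: mpoly_eq0_vanish => u; have [w wu wq] := curves u.
  (* This is q'(t w(t)) / t^k with the division carried out. In the limit only the monomials of
     degree [k] survive, thanks to [0 ^+ 0 = 1]. *)
  pose f t := \sum_(m <- msupp q' | m \in msupp q')
    q'@_m * (t ^+ (mdeg m - k) * \prod_i w i t ^+ m i).
  apply: (@approx0_eq0 f) => [t t01|].
    have /andP[t0 _] := t01; apply: (mulfI (expf_neq0 k (lt0r_neq0 t0))).
    rewrite mulr0 -(wq t t01) -(q'E (fun i => t * w i t)) mevalE /f -big_seq mulr_sumr.
    apply: eq_big_seq => m m_q'; rewrite mulrCA; congr (_ * _).
    under [RHS]eq_bigr do rewrite exprMn.
    by rewrite big_split /= -expr_sum -mdegE mulrA -exprD subnKC ?k_min.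
  rewrite pihomogE raddf_sum /= big_mkcond big_seq /=.
  apply: approx0_sum => m m_q'.
  have -> : (if mdeg m == k then (q'@_m *: 'X_[m]).@[u] else 0)
      = q'@_m * (0 ^+ (mdeg m - k) * \prod_i u i ^+ m i).
    rewrite mevalZ mevalX expr0n subn_eq0 eqn_leq (k_min _ m_q') andbT.
    by case: leqP; rewrite ?mul1r ?mul0r ?mulr0.
  apply/approx0M/approx0M; first exact: approx0_cst.
    exact/approx0X/approx0_id.
  by apply: approx0_prod => i _; apply: approx0X.
have := congr1 (mcoeff m0) low0.
rewrite mcoeff0 pihomogE raddf_sum /= big_mkcond (bigD1_seq m0) //= m0k eqxx.
rewrite mcoeffZ mcoeffX eqxx mulr1 big1 ?addr0 => [/eqP|m /negPf m_m0].
  by rewrite mcoeff_eq0 m0_q'.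
by case: ifP => // _; rewrite mcoeffZ mcoeffX m_m0 mulr0.
Qed.
End LinearApproximation.

(** * Choice of signs *)

(** The singular case of det(M + uv) = det(M) (1 + v M^-1 u). A kernel row y satisfies yM = -(yu)v,
    with yu nonzero because M is invertible. *)
Lemma rank1_update_singular (F : fieldType) (r : nat) (M : 'M[F]_r) (u : 'cV_r) (v : 'rV_r) :
  M \in unitmx -> M + u *m v \notin unitmx -> (v *m invmx M *m u) 0 0 = -1.
Proof.
move=> Mu; rewrite -row_free_unit -kermx_eq0 => /rowV0Pn[y /sub_kermxP].
rewrite mulmxDr mulmxA [y *m u]mx11_scalar; set a := (y *m u) 0 0.
rewrite mul_scalar_mx => /eqP; rewrite addr_eq0 => /eqP yM y0.
have yE : y = - a *: (v *m invmx M).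
  by rewrite -[LHS](mulmxK Mu) yM mulNmx -scalemxAl scaleNr.
have a0 : a != 0 by apply: contraNneq y0 => a0; rewrite yE a0 oppr0 scale0r.
apply: (mulfI a0); rewrite mulrN1 {2}/a yE -scalemxAl mxE scaleNr.
by rewrite ?mxE ?mulNr ?opprK.
Qed.

(** Zeros of [y] become signs one at a time. Setting entry [j] to [c] adds [c] times the rank-one
    matrix [col j A *m row j T]; were both signs singular, one scalar would equal both -1 and 1. *)
Lemma unitmx_signs (F : numFieldType) (r N : nat) (A : 'M[F]_(r, N)) (T : 'M[F]_(N, r))
    (y : 'rV[F]_N) :
    (forall j, y 0 j = 0 \/ y 0 j ^+ 2 = 1) -> A *m diag_mx y *m T \in unitmx ->
  exists2 x : 'rV[F]_N, forall j, x 0 j ^+ 2 = 1 & A *m diag_mx x *m T \in unitmx.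
Proof.
have [k] := ubnP #|[set j | y 0 j == 0]|.
elim: k y => // k IHk y le_k y01 yu.
case: (pickP (fun j => y 0 j == 0)) => [j yj0|y_neq0]; last first.
  by exists y => // j; case: (y01 j) => // /eqP; rewrite y_neq0.
have add_delta c : A *m diag_mx (y + c *: delta_mx 0 j) *m T
    = A *m diag_mx y *m T + (c *: col j A) *m row j T.
  rewrite linearD linearZ /= mulmxDr mulmxDl -scalemxAr -!scalemxAl; congr (_ + _ *: _).
  rewrite colE rowE mulmxA -[A *m _ *m _]mulmxA mul_delta_mx; congr (_ *m _ *m _).
  apply/matrixP => a b; rewrite !mxE eqxx /=; case: (a =P b) => [->|ab].
    by rewrite andbb mulr1n.
  by rewrite mulr0n; case: (a =P j) => // aj; case: (b =P j) => // bj; case: ab; rewrite aj.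
suff [c c2 cu] : exists2 c, c ^+ 2 = 1 &
    A *m diag_mx (y + c *: delta_mx 0 j) *m T \in unitmx.
  apply: (IHk (y + c *: delta_mx 0 j)) => // [|i].
    rewrite ltnS in le_k; apply: leq_trans le_k; apply: proper_card.
    apply/properP; split.
      apply/subsetP => i; rewrite !inE !mxE eqxx /=; case: (i =P j) => [->|_] //.
      by rewrite mulr0 addr0.
    exists j; rewrite ?inE // !mxE !eqxx (eqP yj0) mulr1 add0r.
    by rewrite -sqrf_eq0 c2 oner_eq0.
  rewrite !mxE eqxx /=; case: (i =P j) => [->|_] /=.
    by right; rewrite (eqP yj0) mulr1 add0r.
  by rewrite mulr0 addr0.
case: (boolP (A *m diag_mx (y + 1 *: delta_mx 0 j) *m T \in unitmx)) => [u1|].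
  by exists 1; rewrite ?expr1n.
rewrite add_delta => /(rank1_update_singular yu) e1.
case: (boolP (A *m diag_mx (y + (-1) *: delta_mx 0 j) *m T \in unitmx)) => [u1|].
  by exists (-1); rewrite ?sqrrN ?expr1n.
rewrite add_delta => /(rank1_update_singular yu).
move: e1; rewrite -!scalemxAr scale1r scaleN1r; set Z := _ *m invmx _ *m _ => e1.
rewrite mxE e1 => /eqP.
by rewrite opprK -addr_eq0 -mulr2n pnatr_eq0.
Qed.

(** * Independence of chords of the moment curve *)

Lemma moment_curve_indep (F : idomainType) (I : finType) (J : {set I}) (x : I -> F)
    (x0 : F) (d : nat) (c : I -> F) :
    {in J &, injective x} -> (forall j, j \in J -> x j != x0) -> (#|J| <= d)%N ->
    (forall k : 'I_d, \sum_(j in J) c j * (x0 ^+ k.+1 - x j ^+ k.+1) = 0) ->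
  forall j, j \in J -> c j = 0.
Proof.
move=> x_inj x_neq le_d eqs j jJ.
(* Constant terms cancel in P(x0) - P(x_i), so the relations for the powers 1 to [d] extend to all
   polynomials of degree at most [d]. *)
have poly_eqs (P : {poly F}) : (size P <= d.+1)%N ->
    \sum_(i in J) c i * (P.[x0] - P.[x i]) = 0.
  move=> szP; rewrite (horner_coef_wide _ szP).
  under eq_bigr do rewrite (horner_coef_wide _ szP) -sumrB mulr_sumr.
  rewrite exchange_big big1 //= => k _.
  under eq_bigr do rewrite -mulrBr mulrCA.
  rewrite -mulr_sumr; case: (unliftP ord0 k) => [k' ->|->].
    by rewrite eqs mulr0.
  by rewrite big1 ?mulr0 // => i _; rewrite !expr0 subrr mulr0.
(* [P] has degree |J| and vanishes at [x0] and at every point of [J] except the [j]-th, which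
   isolates [c j]. *)
pose P := ('X - x0%:P) * \prod_(i <- enum (J :\ j)) ('X - (x i)%:P).
have szP : (size P <= d.+1)%N.
  rewrite size_Mmonic ?polyXsubC_eq0 ?monic_prod_XsubC //.
  rewrite size_XsubC size_prod_XsubC -?cardE /=.
  by have := cardsD1 j J; rewrite jJ; lia.
have := poly_eqs P szP; rewrite (bigD1 j) //= big1 ?addr0 => [|i /andP[iJ ij]].
  move/eqP; rewrite !hornerE subrr mul0r sub0r mulf_eq0 => /orP[/eqP //|].
  rewrite oppr_eq0 mulf_eq0 subr_eq0 (negPf (x_neq _ jJ)) /= horner_prod big_enum.
  case/prodf_eq0 => i; rewrite !inE hornerXsubC subr_eq0 => /andP[ij iJ] /eqP xji.
  by case/eqP: ij; apply: x_inj.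
rewrite !hornerE subrr mul0r sub0r horner_prod big_enum (bigD1 i) /= ?inE ?ij //.
by rewrite hornerXsubC subrr mul0r mulr0 oppr0 mulr0.
Qed.

(** * Stresses of points on the moment curve *)

Section Graphs.
Variable n : nat.
Implicit Types (e : edge n) (v : 'I_n) (S : {set edge n}) (U : {set 'I_n}).

Definition incident v e := (edge_src e == v) || (edge_tgt e == v).
Definition opposite v e := if edge_src e == v then edge_tgt e else edge_src e.
Definition edge_inside U e := (edge_src e \in U) && (edge_tgt e \in U).

Lemma edge_neq e : edge_src e != edge_tgt e.
Proof. by rewrite -val_eqE neq_ltn (valP e). Qed.

Lemma opposite_neq v e : incident v e -> opposite v e != v.
Proof.
rewrite /incident /opposite; case: eqP => [<- _|/eqP //].
by rewrite eq_sym edge_neq.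
Qed.

Lemma incident_opposite v e : incident v e -> incident (opposite v e) e.
Proof. by rewrite /incident /opposite; case: eqP => _; rewrite ?eqxx ?orbT. Qed.

Lemma opposite_inj v e1 e2 :
  incident v e1 -> incident v e2 -> opposite v e1 = opposite v e2 -> e1 = e2.
Proof.
rewrite /incident /opposite => i1 i2 eq12; apply: val_inj.
have lt1 : (edge_src e1 < edge_tgt e1)%N := valP e1.
have lt2 : (edge_src e2 < edge_tgt e2)%N := valP e2.
rewrite [val e1]surjective_pairing [val e2]surjective_pairing.
rewrite -/(edge_src _) -/(edge_tgt _) -/(edge_src _) -/(edge_tgt _).
move: i1 i2 eq12 lt1 lt2.
case: (edge_src e1 =P v) => [->|_]; case: (edge_src e2 =P v) => [->|_] //=.
- by move=> _ _ ->.
- by move=> _ /eqP-> -> lt1 /(ltn_trans lt1); rewrite ltnn.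
- by move=> /eqP-> _ <- lt1 /(ltn_trans lt1); rewrite ltnn.
- by move=> /eqP-> /eqP-> ->.
Qed.

Lemma card_edge_inside U S : {in S, forall e, edge_inside U e} -> (#|S| <= 'C(#|U|, 2))%N.
Proof.
move=> SU; rewrite -cards_draws.
pose h e := [set edge_src e; edge_tgt e].
have h_inj : injective h.
  move=> e1 e2 eqh.
  have i1 : incident (edge_src e1) e2.
    by have := set21 (edge_src e1) (edge_tgt e1);
      rewrite -/(h e1) eqh !inE /incident !(eq_sym _ (edge_src e1)).
  have i1' : incident (edge_src e1) e1 by rewrite /incident eqxx.
  apply: (opposite_inj i1' i1); rewrite {1}/opposite eqxx.
  have : edge_tgt e1 \in h e2 by rewrite -eqh set22.
  rewrite !inE => /orP[/eqP t1|/eqP t1]; rewrite /opposite.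
    by rewrite -t1 eq_sym (negPf (edge_neq e1)).
  case: eqP => // /eqP s1; case/orP: i1; rewrite ?(negPf s1) // -t1 eq_sym.
  by rewrite (negPf (edge_neq e1)).
rewrite -(card_imset _ h_inj); apply/subset_leq_card/subsetP => A /imsetP[e eS ->].
rewrite inE cards2 edge_neq eqxx andbT; apply/subsetP => v.
by case/andP: (SU e eS) => sU tU; rewrite !inE => /orP[]/eqP->.
Qed.

Definition degree S v := #|[set e in S | incident v e]|.

Lemma sum_degree S : (\sum_v degree S v = 2 * #|S|)%N.
Proof.
rewrite /degree; under eq_bigr do rewrite -sum1dep_card big_mkcondr /=.
rewrite exchange_big /= mulnC -sum_nat_const; apply: eq_bigr => e _.
rewrite -big_mkcond /= sum1dep_card -(_ : #|[set edge_src e; edge_tgt e]| = 2)%N.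
  by apply: eq_card => v; rewrite !inE /incident !(eq_sym v).
by rewrite cards2 edge_neq.
Qed.

(** Let U be the set of vertices met by S. A vertex of U and its neighbours give |U| >= d + 2, while
    counting degrees gives (d + 1)|U| <= 2|S| <= (d + 2)(d + 1); hence equality throughout. *)
Lemma min_degree_complete d S :
    S != set0 -> (forall v, 0 < degree S v -> d < degree S v)%N -> (#|S| <= 'C(d.+2, 2))%N ->
  #|S| = 'C(d.+2, 2) /\ exists2 U : {set _}, #|U| = d.+2 & {in S, forall e, edge_inside U e}.
Proof.
move=> /set0Pn[e0 e0S] degS cardS; pose U := [set v | (0 < degree S v)%N].
have inU v e : e \in S -> incident v e -> v \in U.
  by move=> eS ve; rewrite inE card_gt0; apply/set0Pn; exists e; rewrite inE eS.
have SU : {in S, forall e, edge_inside U e}.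
  by move=> e eS; rewrite /edge_inside !(inU _ e) // /incident eqxx ?orbT.
have geU : (d.+2 <= #|U|)%N.
  pose v := edge_src e0.
  have vU : v \in U by have /andP[] := SU e0 e0S.
  pose O := opposite v @: [set e in S | incident v e].
  have cardO : #|O| = degree S v.
    rewrite card_in_imset // => e1 e2; rewrite !inE => /andP[_ i1] /andP[_ i2].
    exact: opposite_inj.
  apply: leq_trans (_ : #|v |: O| <= _)%N.
    rewrite cardsU1 cardO -addn1 addnC leq_add //; last by apply: degS; rewrite inE in vU.
    rewrite (_ : v \notin O) //; apply/imsetP => -[e]; rewrite inE => /andP[_ ve] /esym/eqP.
    by rewrite (negPf (opposite_neq ve)).
  apply/subset_leq_card; rewrite subUset sub1set vU; apply/subsetP => w /imsetP[e].
  by rewrite inE => /andP[eS ve] ->; apply: inU eS (incident_opposite ve).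
have le2 : (d.+1 * #|U| <= 2 * #|S|)%N.
  rewrite -sum_degree mulnC -sum_nat_const big_mkcond /=; apply: leq_sum => v _.
  by case: ifP => //; rewrite inE => /degS.
have eqD : (2 * 'C(d.+2, 2) = d.+2 * d.+1)%N.
  by rewrite -mul_bin_diag bin1.
have eqU : #|U| = d.+2.
  apply/eqP; rewrite eqn_leq geU andbT -(leq_pmul2l (ltn0Sn d)).
  by apply: leq_trans le2 _; rewrite (mulnC d.+1) -eqD leq_mul2l.
split; last by exists U.
apply/eqP; rewrite eqn_leq cardS -(leq_pmul2l (ltn0Sn 1)) eqD mulnC -eqU.
by rewrite eqU in le2 *.
Qed.

End Graphs.

Section Rigidity.
Variable F : numFieldType.

(** Half the Jacobian matrix of [mmap] at [p]. *)
Definition rigidity_mx d n (p : 'I_n -> 'I_d -> F) :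
    'M[F]_(#|{: edge n}|, #|{: 'I_n * 'I_d}|) :=
  \matrix_(j, c) let e := enum_val j in let k := (enum_val c).2 in
    (p (edge_src e) k - p (edge_tgt e) k)
    * ((edge_src e == (enum_val c).1)%:R - (edge_tgt e == (enum_val c).1)%:R).

(** Integer parameters keep the points distinct and real, so that squared edge lengths do not vanish
    over the complex numbers. *)
Definition moment_curve d n (i : 'I_n) (k : 'I_d) : F := i%:R ^+ k.+1.

(** Equilibrium at a vertex is a linear relation between the chords to its neighbours. At most [d]
    such chords are independent, so each vertex of the support has degree above [d]. *)
Lemma moment_curve_stress d n (w : edge n -> F) :
    (forall (v : 'I_n) (k : 'I_d),
       \sum_e w e * ((moment_curve (edge_src e) k - moment_curve (edge_tgt e) k)
                     * ((edge_src e == v)%:R - (edge_tgt e == v)%:R)) = 0) ->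
    (#|[set e | w e != 0%R]| <= 'C(d.+2, 2))%N -> (exists e, w e != 0) ->
  #|[set e | w e != 0]| = 'C(d.+2, 2) /\
  exists2 U : {set 'I_n}, #|U| = d.+2 & forall e, w e != 0 -> edge_inside U e.
Proof.
move=> stress cardS [e0 we0]; pose S := [set e | w e != 0].
case: (@min_degree_complete n d S) => // [||->].
- by apply/set0Pn; exists e0; rewrite inE.
- move=> v; rewrite card_gt0 => /set0Pn[e]; rewrite !inE => /andP[/negPf we ve].
  rewrite ltnNge; apply/negP => le_d; suff: w e = 0 by move/eqP; rewrite we.
  pose J := [set e in S | incident v e].
  apply: (@moment_curve_indep _ _ J (fun e => (opposite v e)%:R) v%:R d w) => //.
  + move=> e1 e2; rewrite !inE => /andP[_ i1] /andP[_ i2] /eqP.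
    by rewrite eqr_nat => /eqP/val_inj; apply: opposite_inj.
  + by move=> e1; rewrite !inE => /andP[_ i1]; rewrite eqr_nat opposite_neq.
  + move=> k; rewrite -[RHS](stress v k) big_mkcond; apply: eq_bigr => e1 _.
    rewrite !inE; case: eqP => [->|_] /=; first by rewrite mul0r.
    rewrite /incident /opposite /moment_curve.
    case: (edge_src e1 =P v) => [<-|_] /=.
      by rewrite eq_sym (negPf (edge_neq e1)) subr0 mulr1.
    case: eqP => [->|_]; last by rewrite subrr !mulr0.
    by rewrite sub0r mulrN1 opprB.
  + by rewrite inE inE we.
by case=> U cardU SU; split=> //; exists U => // e we; apply: SU; rewrite inE.
Qed.

Lemma rigidity_dependent_complete d n r (g : 'I_r -> 'I_#|{: edge n}|) :
    injective g -> (r <= 'C(d.+2, 2))%N ->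
    ~~ row_free (rowsub g (rigidity_mx (@moment_curve d n))) ->
  r = 'C(d.+2, 2) /\
  exists2 U : {set 'I_n}, #|U| = d.+2 & forall i, edge_inside U (enum_val (g i)).
Proof.
move=> g_inj le_r; rewrite -kermx_eq0 => /rowV0Pn[y /sub_kermxP yR y0].
pose h i := enum_val (g i); have h_inj : injective h.
  by move=> i j /enum_val_inj/g_inj.
(* The kernel row, extended by 0 to the edges outside the image of [h], is a stress. Its support has
   ['C(d.+2, 2)] edges, hence fills that image. *)
pose w e := \sum_(i | h i == e) y 0 i.
have wh i : w (h i) = y 0 i.
  by rewrite /w (big_pred1 i) // => j; rewrite (inj_eq h_inj).
have wsub : [set e | w e != 0] \subset h @: [set: 'I_r].
  apply/subsetP => e; rewrite inE; apply: contraNT => eNh.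
  rewrite /w big_pred0 // => i; apply/eqP => he; case/negP: eNh.
  by rewrite -he imset_f.
have card_h : #|h @: [set: 'I_r]| = r by rewrite card_imset // cardsT card_ord.
case: (@moment_curve_stress d n w).
- move=> v k; have := congr1 (fun M : 'rV_ _ => M 0 (enum_rank (v, k))) yR.
  rewrite !mxE => eq0; rewrite -[RHS]eq0.
  under [RHS]eq_bigr do rewrite !mxE enum_rankK /=.
  under [LHS]eq_bigr do rewrite /w mulr_suml.
  rewrite [RHS](partition_big h predT) //=; apply: eq_bigr => e _.
  by apply: eq_bigr => i /eqP <-.
- by apply: leq_trans le_r; rewrite -card_h subset_leq_card.
- case/rV0Pn: y0 => i yi; exists (h i); by rewrite wh.
move=> cardw [U cardU wU]; have eqr : r = 'C(d.+2, 2).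
  by apply/eqP; rewrite eqn_leq le_r -cardw -card_h subset_leq_card.
split=> //; exists U => // i; apply: wU; rewrite -/(h i).
have /eqP weq : [set e | w e != 0] == h @: [set: 'I_r].
  by rewrite eqEcard wsub card_h cardw eqr leqnn.
have : h i \in h @: [set: 'I_r] by rewrite imset_f.
by rewrite -weq inE.
Qed.

End Rigidity.

(** * Dimension of the image of L *)

(** Half the rate of change of a squared edge length when the configuration moves with velocity
    [a]. *)
Lemma rigidity_mxE (F : numFieldType) d n (p : 'I_n -> 'I_d -> F)
    (a : 'cV[F]_#|{: 'I_n * 'I_d}|) j :
  let av v k := a (enum_rank (v, k)) 0 in
  (rigidity_mx p *m a) j 0
  = \sum_(k < d) (p (edge_src (enum_val j)) k - p (edge_tgt (enum_val j)) k)
                 * (av (edge_src (enum_val j)) k - av (edge_tgt (enum_val j)) k).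
Proof.
move=> av; set s := edge_src _; set t := edge_tgt _; rewrite mxE.
rewrite (reindex enum_rank) /=; last exact/onW_bij/enum_rank_bij.
rewrite (eq_bigr (fun c => (p s c.2 - p t c.2) * ((s == c.1)%:R - (t == c.1)%:R) * av c.1 c.2)).
  rewrite -(pair_bigA _ (fun v k => (p s k - p t k) * ((s == v)%:R - (t == v)%:R) * av v k)).
  rewrite exchange_big; apply: eq_bigr => k _.
  under eq_bigr do rewrite -mulrA.
  rewrite -mulr_sumr; congr (_ * _).
  under eq_bigr do rewrite mulrBl.
  rewrite sumrB; congr (_ - _).
    rewrite (bigD1 s) //= eqxx mul1r big1 ?addr0 // => v /negPf.
    by rewrite eq_sym => ->; rewrite mul0r.
  rewrite (bigD1 t) //= eqxx mul1r big1 ?addr0 // => v /negPf.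
  by rewrite eq_sym => ->; rewrite mul0r.
by move=> [v k] _; rewrite mxE enum_rankK.
Qed.

Section Density.
Variable R : realType.
Local Notation C := R[i].

(** For every direction [u], a curve on L is found whose image starts with velocity [u] in the
    coordinates [f]; [mpoly_eq0_curves] then applies. *)
Lemma coords_indep_rigid d n D r (E : 'M[C]_(D, #|{: edge n}|)) (p : 'I_n -> 'I_d -> C)
    (f : 'I_r -> 'I_D) (g : 'I_r -> 'I_#|{: edge n}|) :
    (forall e, Defs.mmap p e != 0) -> injective g -> mxsub f g E \in unitmx ->
    row_free (rowsub g (rigidity_mx p)) ->
  coords_indep_on (mx_image E (@Lset R d n)) f.
Proof.
move=> m_neq0 g_inj Eu /row_freeP[J RJ] q q0.
pose A := rowsub f E; pose l0 (j : 'I_#|{: edge n}|) : C := sqrtC (Defs.mmap p (enum_val j)).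
have l0_neq0 j : l0 j != 0 by rewrite sqrtC_eq0.
(* Up to signs, [T] sends parameters to tangent vectors of L; the right inverse [J] of the selected
   rigidity rows makes its rows along [g] diagonal. *)
pose T := diag_mx (\row_j (l0 j)^-1) *m rigidity_mx p *m J.
have [x x2 xu] : exists2 x : 'rV[C]_#|{: edge n}|, forall j, x 0 j ^+ 2 = 1 &
    A *m diag_mx x *m T \in unitmx.
  apply: (@unitmx_signs _ _ _ _ _ (\row_j (j \in g @: [set: 'I_r])%:R)) => [j|].
    by rewrite mxE; case: (j \in g @: [set: 'I_r]); [right; rewrite expr1n | left].
  have -> : A *m diag_mx (\row_j (j \in g @: [set: 'I_r])%:R) *m T
      = mxsub f g E *m diag_mx (\row_i (l0 (g i))^-1).
    have Tg i k : T (g i) k = (l0 (g i))^-1 * (i == k)%:R.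
      rewrite /T -mulmxA mul_diag_mx !mxE; congr (_ * _).
      have := congr1 (fun M : 'M_ _ => M i k) RJ; rewrite mul_rowsub_mx !mxE => <-.
      by apply: eq_bigr => c _; rewrite !mxE.
    apply/matrixP => i k; rewrite !mul_mx_diag !mxE.
    transitivity (\sum_(j in g @: [set: 'I_r]) A i j * T j k).
      rewrite [RHS]big_mkcond; apply: eq_bigr => j _; rewrite mxE [X in _ * X * _]mxE.
      by case: (j \in _); rewrite ?mulr1 // mulr0 mul0r.
    rewrite big_imset => [|? ? _ _ /g_inj //]; rewrite (bigD1 k) ?inE //= Tg eqxx mulr1.
    rewrite big1 ?addr0 ?mxE // => m /andP[_ /negPf mk].
    by rewrite Tg mk !mulr0.
  rewrite unitmx_mul Eu /= unitmxE det_diag unitfE; apply/prodf_neq0 => i _.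
  by rewrite mxE invr_neq0.
pose l j := x 0 j * l0 j.
have l_neq0 j : l j != 0 by rewrite mulf_neq0 // -sqrf_eq0 x2 oner_eq0.
apply: (@mpoly_eq0_curves _ _ _ (fun i => \sum_j A i j * l j)) => u.
pose c := invmx (A *m diag_mx x *m T) *m \col_i u i.
pose a := J *m c; pose av v k := a (enum_rank (v, k)) 0.
(* As [x 0 j] is its own inverse, the leading factor is 1 / l_j, and [vel] is the derivative of the
   signed length. *)
pose vel j := x 0 j * (l0 j)^-1 * (rigidity_mx p *m a) j 0.
have Avel i : \sum_j A i j * vel j = u i.
  have := congr1 (fun M : 'cV_ _ => M i 0) (mulKVmx xu (\col_i u i)).
  rewrite /= -/c [RHS]mxE => <-; rewrite /T -!mulmxA mxE; apply: eq_bigr => j _.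
  congr (_ * _); rewrite mul_diag_mx mxE mul_diag_mx [in RHS]mxE mxE.
  by rewrite /vel -mulrA.
pose pt t v k := p v k + t * av v k.
have [y y2 yv] : exists2 y : 'I_#|{: edge n}| -> C -> C,
    forall j t, y j t ^+ 2 = Defs.mmap (pt t) (enum_val j) &
    forall j, approx0 (fun t => (y j t - l j) / t) (vel j).
  apply: (@fin_all_exists2 _ (fun=> C -> C)
    (fun j y => forall t, y t ^+ 2 = Defs.mmap (pt t) (enum_val j))
    (fun j y => approx0 (fun t => (y t - l j) / t) (vel j))) => j.
  apply: sqrt_approx => //.
  (* Along a straight motion the difference quotient of a squared length is affine in [t]; the null
     summand displays the limit of its linear term. *)
  have -> : 2 * l j * vel j = 2 * (rigidity_mx p *m a) j 0 + 0 * \sum_(k < d)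
      (av (edge_src (enum_val j)) k - av (edge_tgt (enum_val j)) k) ^+ 2.
    rewrite mul0r addr0 /l /vel -[in RHS](mul1r (_ j 0)) -(x2 j); field.
    exact: l0_neq0.
  pose f2 t : C := 2 * (rigidity_mx p *m a) j 0 + t * \sum_(k < d)
      (av (edge_src (enum_val j)) k - av (edge_tgt (enum_val j)) k) ^+ 2.
  apply: (@approx0_ext _ f2) => [t /andP[t0 _]|]; last first.
    apply: approx0D; first exact: approx0_cst.
    by apply: approx0M; [apply: approx0_id | apply: approx0_cst].
  have t_neq0 : t != 0 by rewrite gt_eqF.
  apply: (canRL (mulfK t_neq0)); rewrite /l exprMn x2 mul1r sqrtCK.
  rewrite /f2 rigidity_mxE /Defs.mmap -sumrB [_ * t]mulrC mulrDr mulrA [t * 2]mulrC mulrA.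
  rewrite !mulr_sumr -big_split /=; apply: eq_bigr => k _; rewrite /pt -/(av _ _) -/(av _ _).
  by ring.
exists (fun i t => \sum_j A i j * ((y j t - l j) / t)) => [i|t /andP[t0 _]].
  by rewrite -Avel; apply: approx0_sum => j _; apply: approx0M (approx0_cst _) (yv j).
pose lt e := y (enum_rank e) t.
(* Any choice of square roots of the squared lengths gives a point of L. *)
transitivity (q.@[fun j => mx_apply E lt (f j)]); last first.
  apply: q0; exists lt; split=> //; exists (pt t); apply/funext => e.
  by rewrite /lt y2 enum_rankK.
apply: meval_eq => i; rewrite /mx_apply mulr_sumr -big_split; apply: eq_bigr => j _ /=.
have -> : E (f i) j = A i j by rewrite mxE.
by rewrite /lt enum_valK; field; rewrite gt_eqF.
Qed.

(** A linear relation between the rows [f] of [E] is a linear polynomial vanishing on the image of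
    any set. *)
Lemma coords_indep_leq_rank D n k (E : 'M[C]_(D, #|{: edge n}|)) (S : _ -> Prop)
    (f : 'I_k -> 'I_D) :
  coords_indep_on (mx_image E S) f -> (k <= \rank E)%N.
Proof.
move=> indep; suff rf : row_free (rowsub f E).
  by rewrite -(eqP rf) mxrankS ?rowsub_sub.
rewrite -kermx_eq0; apply/negPn/negP => /rowV0Pn[y /sub_kermxP yE] /rV0Pn yN0.
case: yN0 => i; apply/negP/negPn/eqP.
have /indep q0 w : mx_image E S w -> (\sum_j y 0 j *: 'X_j : {mpoly C[k]}).@[fun j => w (f j)] = 0.
  move=> [l [_ ->]]; rewrite raddf_sum /=.
  under eq_bigr do rewrite mevalZ mevalXU /mx_apply mulr_sumr.
  rewrite exchange_big big1 //= => j _.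
  have := congr1 (fun M : 'rV_ _ => M 0 j * l (enum_val j)) yE.
  rewrite /= !mxE mul0r mulr_suml => eq0; rewrite -[RHS]eq0.
  by apply: eq_bigr => b _; rewrite mxE mulrA.
have := congr1 (mcoeff U_(i)) q0; rewrite mcoeff0 raddf_sum /= (bigD1 i) //=.
rewrite mcoeffZ mcoeffX eqxx mulr1 big1 ?addr0 => [->//|j ji].
by rewrite mcoeffZ mcoeffX eq_mnm1 (negPf ji) mulr0.
Qed.

(** A sum of real squares whose first term is nonzero, the first coordinates being distinct
    integers. *)
Lemma mmap_moment_curve_neq0 d n e : (0 < d)%N ->
  Defs.mmap (@moment_curve C d n) e != 0.
Proof.
case: d => // d _; rewrite /Defs.mmap.
have real_sq k :
    0 <= (@moment_curve C d.+1 n (edge_src e) k - @moment_curve C d.+1 n (edge_tgt e) k) ^+ 2.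
  by apply: real_exprn_even_ge0 => //; rewrite realB // realX // realn.
rewrite psumr_neq0 //; apply/hasP; exists ord0; rewrite ?mem_index_enum //=.
rewrite lt0r real_sq andbT expf_neq0 // subr_eq0 /moment_curve !expr1 eqr_nat.
exact: edge_neq.
Qed.

End Density.

(** * Column exchange and uniqueness of the complete subgraph *)

Lemma basis_exchange (F : fieldType) r N (A : 'M[F]_(r, N)) (g : 'I_r -> 'I_N) j :
    colsub g A \in unitmx -> col j A != 0 ->
  exists k, colsub (fun i => if i == k then j else g i) A \in unitmx.
Proof.
(* In the basis of columns [g], column [j] may replace column [k] as soon as its [k]-th coordinate
   is nonzero. *)
move=> gu jA; pose B := invmx (colsub g A) *m A.
have Bg : colsub g B = 1%:M by rewrite /B -mulmx_colsub mulVmx.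
have Bj : col j B != 0.
  apply: contraNneq jA => Bj.
  by rewrite -[A](mulKVmx gu) -/B colE -mulmxA -colE Bj mulmx0.
have [k Bk] : exists k, B k j != 0.
  case/cV0Pn: Bj => k; rewrite mxE => Bk; by exists k.
pose g' i := if i == k then j else g i.
have gE : colsub g' A = colsub g A *m colsub g' B.
  by rewrite /B -mulmx_colsub mulKVmx.
exists k; rewrite gE unitmx_mul gu /= -row_free_unit -kermx_eq0; apply/rowV0P => y /sub_kermxP yB.
have Bgi i m : B m (g i) = (m == i)%:R.
  by have := congr1 (fun M : 'M_ _ => M m i) Bg; rewrite !mxE.
have y0 i : i != k -> y 0 i = 0.
  move=> ik; have := congr1 (fun M : 'rV_ _ => M 0 i) yB.
  rewrite !mxE (bigD1 i) //= mxE /g' (negPf ik) Bgi eqxx mulr1 big1 ?addr0 // => m mi.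
  by rewrite mxE (negPf ik) Bgi (negPf mi) mulr0.
apply/rowP => i; rewrite mxE; have [->|/y0 //] := eqVneq i k.
have := congr1 (fun M : 'rV_ _ => M 0 k) yB.
rewrite !mxE (bigD1 k) //= big1 ?addr0 => [|m /y0->]; last by rewrite mul0r.
by move/eqP; rewrite mxE /g' eqxx mulf_eq0 (negPf Bk) orbF => /eqP.
Qed.

Lemma colsub_unit_inj (F : fieldType) r N (A : 'M[F]_(r, N)) (g : 'I_r -> 'I_N) :
  colsub g A \in unitmx -> injective g.
Proof.
move=> gu i j gij; apply/eqP; apply: contraTT gu => ij.
rewrite unitmxE unitfE negbK -det_tr; apply/eqP/(determinant_alternate ij) => k.
by rewrite !mxE gij.
Qed.

Theorem theorem4p2 (R : realType) (d n r : nat)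
  (E : 'M[R[i]]_('C(d.+2, 2), #|{: edge n}|)) :
  (1 <= d)%N -> (2 <= n)%N -> \rank E = r ->
  ~ zdim_eq (mx_image E (@Lset R d n)) r ->
  r = 'C(d.+2, 2) /\ has_K_support E d.+2.
Proof.
move=> d_gt0 _ <- {r} not_dim; set r := \rank E in not_dim *.
have le_r : (r <= 'C(d.+2, 2))%N by apply: rank_leq_row.
pose f := maxrankfun E; pose A := rowsub f E.
have A_free : row_free A by apply: maxrowsub_free.
(* If the edges of a column basis were independent on the moment curve, the image would have
   dimension [r], with the rank as upper bound. *)
have basis_in g : colsub g A \in unitmx -> r = 'C(d.+2, 2) /\
    exists2 U : {set 'I_n}, #|U| = d.+2 & forall i, edge_inside U (enum_val (g i)).
  move=> gu; have g_inj := colsub_unit_inj gu.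
  apply: (@rigidity_dependent_complete R[i]) => //; apply/negP => free_g; case: not_dim.
  split=> [|k h _]; last exact: coords_indep_leq_rank.
  exists f; split; first exact: maxrankfun_inj.
  apply: coords_indep_rigid g_inj _ free_g => [e|]; first exact: mmap_moment_curve_neq0.
  by move: gu; rewrite -mxsub_comp.
have At_full : row_full A^T by rewrite /row_full mxrank_tr; apply: A_free.
pose g := fullrankfun At_full.
have gu : colsub g A \in unitmx.
  by have := fullrowsub_unit At_full; rewrite -unitmx_tr trmx_mxsub trmxK.
have [eq_r [U cardU gU]] := basis_in g gu; split=> //; exists U; split=> // e eU i.
set j := enum_rank e; suff : col j E = 0.
  by move=> /(congr1 (fun M : 'cV_ _ => M i 0)); rewrite !mxE.
suff Aj : col j A = 0.
  have /submxP[B ->] : (E <= A)%MS by rewrite eq_maxrowsub.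
  by rewrite colE -mulmxA -colE Aj mulmx0.
apply/eqP/negPn/negP => /(basis_exchange gu)[k ku].
have [_ [U' cardU' gU']] := basis_in _ ku.
have jU' : edge_inside U' e by have := gU' k; rewrite eqxx /j enum_rankK.
(* The [r - 1] columns common to both bases have their edges inside [U] and [U'], which differ
   because [U'] contains [e]. *)
pose S := [set enum_val (g i) | i in [set~ k]].
have SU : {in S, forall e', edge_inside (U :&: U') e'}.
  move=> e' /imsetP[m mk ->]; rewrite !inE in mk; have := gU' m; rewrite (negPf mk).
  have /andP[s1 t1] := gU m; case/andP => s2 t2.
  by rewrite /edge_inside !inE s1 s2 t1.
have cardS : #|S| = r.-1.
  by rewrite card_imset ?cardsC1 ?card_ord // => a b /enum_val_inj/(colsub_unit_inj gu).
have ltU : (#|U :&: U'| < d.+2)%N.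
  rewrite -cardU; apply: proper_card; rewrite properE subsetIl /=.
  apply: contra eU => /subsetP sU; have eqU : U = U'.
    apply/eqP; rewrite eqEcard cardU cardU' leqnn andbT; apply/subsetP => v /sU.
    by rewrite inE => /andP[].
  by rewrite eqU.
have := card_edge_inside SU; rewrite cardS eq_r; apply/negP; rewrite -ltnNge.
have le_bin : ('C(#|U :&: U'|, 2) <= 'C(d.+1, 2))%N by apply: leq_bin2l.
(* The binomials 'C(d+2, 2) and 'C(d+1, 2) differ by d + 1, which is at least 2 since [1 <= d]; so
   [r - 1] edges do not fit on d + 1 vertices. *)
by apply: leq_ltn_trans le_bin _; rewrite (binS d.+1) bin1; lia.
Qed.
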